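(* Let $w(x)$ and $p(x)$ be polynomials, fix one of the two signs $\pm$, and let $g(x)=\sum_{n\ge0}g_nx^n$ be a power series which is the expansion of $$g(x)=\exp\bigl[w(x)\pm\sqrt{p(x)}\bigr].$$ Define the polynomials (with the corresponding choice of upper or lower signs) $$T=\mp4p'p=\sum_{n\ge0}T_nx^n,$$ $$R=\pm2\,(2p''p-p'^2+4w'p'p)=\sum_{n\ge0}R_nx^n,$$ $$Q=\pm\,(4p'pw''-4p'pw'^2+p'^3-4w'p''p+2w'p'^2)=\sum_{n\ge0}Q_nx^n .$$ Then for every integer $n\ge0$ $$\sum_{j\ge0}\bigl[(n-j)(n-j-1)T_j+(n-j)R_{j-1}+Q_{j-2}\bigr]g_{n-j}=0 .$$
   Context: Polynomials have complex coefficients. Primes denote $d/dx$, and e.g. $p'^2$ means $(p')^2$. Coefficients $T_j,R_j,Q_j$ with negative index or index exceeding the degree, and $g_m$ with $m<0$, are zero, so the sum is finite. The statement that the power series $g(x)=\sum_{n\ge0}g_nx^n$ is the expansion of the given expression means: $g$ has a positive radius of convergence, and on some non-empty open connected subset of its disc of convergence $g$ equals the given expression for some choice of analytic branch of the square root. *)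

(* Defs.v *)
(* The complex numbers are R[i] for R : realType. *)
From mathcomp Require Import all_boot all_order all_algebra.
From mathcomp Require Import complex.
From mathcomp Require Import all_classical all_reals all_analysis.

Set Implicit Arguments.
Unset Strict Implicit.
Unset Printing Implicit Defensive.

Import Order.TTheory GRing.Theory Num.Theory.
Import numFieldNormedType.Exports.

Local Open Scope classical_set_scope.
Local Open Scope ring_scope.

(* The topology of R[i] is carried by the regular module R[i]^o (the same type
   as R[i]).  The library's pseries, exp_coeff and expR are restricted to a
   realType, hence the complex counterparts here. *)
Definition cpseries (R : realType) (a : nat -> R[i]) (z : R[i]^o) :
  nat -> R[i]^o := [series (a k * z ^+ k : R[i]^o)]_k.

Definition cpsum (R : realType) (a : nat -> R[i]) (z : R[i]^o) : R[i]^o :=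
  limn (cpseries a z).

(* `|z| lives in R[i] with zero imaginary part; Re brings it back to R. *)
Definition cvg_radius (R : realType) (a : nat -> R[i]) : \bar R :=
  ereal_sup [set (complex.Re `|z|)%:E | z in [set z | cvgn (cpseries a z)]].

Definition cvg_disc (R : realType) (a : nat -> R[i]) : set R[i]^o :=
  [set z | ((complex.Re `|z|)%:E < cvg_radius a)%E].

Definition cexp (R : realType) (z : R[i]^o) : R[i]^o :=
  cpsum (fun k => (k`!%:R)^-1) z.

(* Differentiation is over the field R[i]: the increment ranges over R[i], so
   derivability in direction 1 is complex differentiability. *)
Definition holomorphic_on (R : realType) (U : set R[i]^o)
    (h : R[i]^o -> R[i]^o) : Prop :=
  forall z, U z -> derivable h z 1.

Definition analytic_sqrt_branch (R : realType) (p : {poly R[i]})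
    (U : set R[i]^o) (h : R[i]^o -> R[i]^o) : Prop :=
  holomorphic_on U h /\ forall z, U z -> h z ^+ 2 = p.[z].

(* e = 1 or e = -1 is the chosen sign; U need not contain 0. *)
Definition is_expansion_exp_sqrt (R : realType) (e : R[i]) (w p : {poly R[i]})
    (g : nat -> R[i]) : Prop :=
  (0 < cvg_radius g)%E /\
  exists (U : set R[i]^o) (h : R[i]^o -> R[i]^o),
    [/\ U !=set0, open U, connected U & U `<=` cvg_disc g] /\
    analytic_sqrt_branch p U h /\
    forall z, U z -> cpsum g z = cexp (w.[z] + e * h z).

Definition polyT (R : realType) (e : R[i]) (p : {poly R[i]}) : {poly R[i]} :=
  - (e *: (4 * p^`() * p)).

Definition polyR (R : realType) (e : R[i]) (w p : {poly R[i]}) : {poly R[i]} :=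
  e *: (2 * (2 * p^`(2) * p - p^`() ^+ 2 + 4 * w^`() * p^`() * p)).

Definition polyQ (R : realType) (e : R[i]) (w p : {poly R[i]}) : {poly R[i]} :=
  e *: (4 * p^`() * p * w^`(2) - 4 * p^`() * p * w^`() ^+ 2 + p^`() ^+ 3
        - 4 * w^`() * p^`(2) * p + 2 * w^`() * p^`() ^+ 2).

(* Extension by zero to negative indices; for a polynomial, nth 0 is already
   zero beyond the degree. *)
Definition zcoef (K : nmodType) (a : nat -> K) (k : int) : K :=
  match k with Posz m => a m | Negz _ => 0 end.

(* Main.v *)
(* Write y = g' - w' g.  Where h^2 = p and g = exp (w + e h), the derivative is
   g' = (w' + e h') g, and 2 h h' = p', so that 2 p y = e p' h g.  Differentiating
   this relation and eliminating h with e^2 = 1 yields T g'' + R g' + Q g = 0 on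
   U.  The left-hand side of the recurrence is the n-th coefficient of the power
   series x^2 (T g'' + R g' + Q g), which therefore vanishes on U, and one is left
   with the identity theorem for power series.

   The identity theorem is proved without recentring the series.  Normalise to the
   unit disc.  If f (z) = 0, multiplication by the inverse Blaschke factor
   (1 - z^* x) / (x - z) keeps the l^2 norm of the coefficients and the other
   zeros, and divides |f (0)| by |z|.  With k zeros of modulus at most q < 1 this
   gives |f (0)| <= ||f|| q^k, so infinitely many such zeros force f (0) = 0; then
   divide by x and repeat. *)
Require Import Defs.
From mathcomp Require Import all_boot all_order all_algebra.
From mathcomp Require Import complex.
From mathcomp Require Import all_classical all_reals all_analysis.
From mathcomp Require Import ring.
Set Implicit Arguments.
Unset Strict Implicit.
Unset Printing Implicit Defensive.
Import Order.TTheory GRing.Theory Num.Theory.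
Import numFieldNormedType.Exports.
Local Open Scope classical_set_scope.
Local Open Scope ring_scope.

(* The only consequence of the completeness of R[i] that is needed. *)
Definition geom_complete (K : numFieldType) : Prop :=
  forall (u : nat -> K) (C q : K), 0 <= q -> q < 1 ->
    (forall n, `|u n| <= C * q ^+ n) -> cvgn (series u).

(** A Cauchy estimate on the coefficients. It plays the part of a radius of convergence and survives
    the operations below with explicit constants. *)
Definition geom_bounded (K : numFieldType) (a : nat -> K) (r : K) : Prop :=
  exists C, forall n, `|a n| * r ^+ n <= C.

Definition has_psum (K : numFieldType) (a : nat -> K) (z l : K) : Prop :=
  series (fun k => a k * z ^+ k) @ \oo --> l.

Definition psum (K : numFieldType) (a : nat -> K) (z : K) : K :=
  limn (series (fun k => a k * z ^+ k)).

(** * Convergence of power series and division by [x - z] *)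

Section PowerSeries.
Variables (K : numFieldType).
Implicit Types (a b : nat -> K) (r z l : K).

Lemma has_psumE a z l : has_psum a z l -> psum a z = l.
Proof. by move=> al; apply: cvg_lim al. Qed.

Lemma has_psumD a b z l l' : has_psum a z l -> has_psum b z l' ->
  has_psum (fun n => a n + b n) z (l + l').
Proof.
move=> al bl; rewrite /has_psum.
under [X in series X]eq_fun do rewrite mulrDl.
have -> : series (fun k => a k * z ^+ k + b k * z ^+ k) =
  (fun n => series (fun k => a k * z ^+ k) n + series (fun k => b k * z ^+ k) n).
  by apply/funext => n; rewrite /series /= big_split.
exact: cvgD.
Qed.

Lemma has_psumZ a z l c : has_psum a z l -> has_psum (fun n => c * a n) z (c * l).
Proof.
move=> al; rewrite /has_psum.
have -> : series (fun k => c * a k * z ^+ k) =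
  (fun n => c * series (fun k => a k * z ^+ k) n).
  apply/funext => n; rewrite /series /= mulr_sumr.
  by apply: eq_bigr => i _; rewrite mulrA.
by apply: cvgM al; exact: cvg_cst.
Qed.

Lemma has_psum_behead a z l :
  has_psum (fun n => a n.+1) z l -> has_psum a z (a 0%N + z * l).
Proof.
move=> al; rewrite /has_psum -cvg_shiftS.
rewrite [X in X @ _ --> _](_ : _ =
  (fun n => a 0%N + z * series (fun k => a k.+1 * z ^+ k) n)); last first.
  apply/funext => n; rewrite /series /= big_nat_recl // expr0 mulr1 mulr_sumr.
  by congr (_ + _); apply: eq_bigr => i _; rewrite exprS mulrCA.
by apply: cvgD; [exact: cvg_cst|apply: cvgM al; exact: cvg_cst].
Qed.

Lemma has_psum_shift a z l : has_psum a z l ->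
  has_psum (fun n => if n is m.+1 then a m else 0) z (z * l).
Proof. by move=> al; rewrite -[z * l]add0r; apply: has_psum_behead. Qed.

Lemma norm_lim_le (u : nat -> K) l M :
  u @ \oo --> l -> (forall n, `|u n| <= M) -> `|l| <= M.
Proof.
(* The order of [K] is partial, so negating [<=] first requires [M] to be real; it is, being above a
   norm. *)
move=> ul uM; have Mr : M \is Num.real by rewrite ger0_real// (le_trans _ (uM 0)).
rewrite real_leNgt ?normr_real //; apply/negP => Ml.
have e0 : 0 < `|l| - M by rewrite subr_gt0.
have /cvgrPdist_lt /(_ _ e0) [N _ /(_ N (leqnn N)) /=] := ul.
apply/negP; rewrite le_gtF // lerBlDr -{1}(subrK (u N) l); apply: le_trans (ler_normD _ _) _.
by rewrite lerD2l.
Qed.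

Lemma sum_geom_le (C q : K) n : 0 <= C -> 0 <= q -> q < 1 ->
  \sum_(0 <= i < n) C * q ^+ i <= C / (1 - q).
Proof.
move=> C0 q0 q1; have q1' : 0 < 1 - q by rewrite subr_gt0.
rewrite -mulr_sumr ler_wpM2l // -[leRHS]div1r ler_pdivlMr //.
rewrite mulrC -opprB mulNr big_mkord -subrX1 opprB lerBlDr lerDl.
exact: exprn_ge0.
Qed.

Hypothesis hK : geom_complete K.

(** [K] carries no Archimedean hypothesis; the decay comes from [geom_complete], as the terms of a
    convergent series tend to 0. *)
Lemma geom_cvg0 (C q : K) : 0 <= q -> q < 1 -> (fun n => C * q ^+ n) @ \oo --> (0 : K).
Proof.
move=> q0 q1; apply: cvg_series_cvg_0; apply: (@hK _ `|C| q) => // n.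
by rewrite normrM normrX (ger0_norm q0).
Qed.

Lemma geom_bounded_ge0 a r C : (forall n, `|a n| * r ^+ n <= C) -> 0 <= C.
Proof. by move=> /(_ 0%N); rewrite expr0 mulr1; apply: le_trans. Qed.

Lemma norm_term_le a r z C n : `|z| < r -> `|a n| * r ^+ n <= C ->
  `|a n * z ^+ n| <= C * (`|z| / r) ^+ n.
Proof.
move=> zr aC; have r0 : 0 < r by apply: le_lt_trans zr.
rewrite normrM normrX expr_div_n mulrA ler_pdivlMr ?exprn_gt0 // mulrAC.
by rewrite ler_wpM2r ?exprn_ge0.
Qed.

Lemma ratio_bounds r z : `|z| < r -> 0 <= `|z| / r /\ `|z| / r < 1.
Proof.
move=> zr; have r0 : 0 < r by apply: le_lt_trans zr.
by rewrite divr_ge0 ?(ltW r0) //= ltr_pdivrMr // mul1r.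
Qed.

Lemma geom_bounded_has_psum a r z : geom_bounded a r -> `|z| < r ->
  has_psum a z (psum a z).
Proof.
move=> [C aC] zr; have [q0 q1] := @ratio_bounds _ _ zr.
by apply: (@hK _ C _ q0 q1) => n; apply: norm_term_le.
Qed.

Lemma norm_psum_le a r z C : (forall n, `|a n| * r ^+ n <= C) -> `|z| < r ->
  `|psum a z| <= C / (1 - `|z| / r).
Proof.
move=> aC zr; have [q0 q1] := @ratio_bounds _ _ zr.
have aS : has_psum a z (psum a z) by apply: geom_bounded_has_psum zr; exists C.
apply: norm_lim_le aS _ => n; rewrite /series /=.
apply: le_trans (ler_norm_sum _ _ _) _.
apply: le_trans (@sum_geom_le _ _ n (@geom_bounded_ge0 _ _ _ aC) q0 q1).
by apply: ler_sum => i _; apply: norm_term_le.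
Qed.

(* The coefficients of (f(x) - f(z)) / (x - z) for f the sum of a. *)
Definition quot a z n : K := psum (fun j => a (n.+1 + j)%N) z.

Lemma geom_bounded_drop a r m : 0 < r -> geom_bounded a r ->
  geom_bounded (fun j => a (m + j)%N) r.
Proof.
move=> r0 [C aC]; exists (C / r ^+ m) => n.
by rewrite ler_pdivlMr ?exprn_gt0 // -mulrA -exprD addnC.
Qed.

(** The tail starting at [n.+1] satisfies the same kind of bound with constant [C / r ^+ n.+1], so
    summing it geometrically yields the factor needed against [r ^+ n]. No radius is lost. *)
Lemma geom_bounded_quot a r z : `|z| < r -> geom_bounded a r ->
  geom_bounded (quot a z) r.
Proof.
move=> zr [C aC]; have r0 : 0 < r by apply: le_lt_trans zr.
have [q0 q1] := @ratio_bounds _ _ zr.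
exists (C / r / (1 - `|z| / r)) => n.
have aC' k : `|a (n.+1 + k)%N| * r ^+ k <= C / r ^+ n.+1.
  by rewrite ler_pdivlMr ?exprn_gt0 // -mulrA -exprD addnC.
apply: le_trans (ler_wpM2r (exprn_ge0 n (ltW r0)) (@norm_psum_le _ _ _ _ aC' zr)) _.
rewrite le_eqVlt; apply/orP; left; apply/eqP.
have : 1 - `|z| / r != 0 by rewrite gt_eqF // subr_gt0.
rewrite exprSr; move: (1 - _) => d d0; field.
by rewrite d0 expf_neq0 ?gt_eqF.
Qed.

Lemma quotS a r z n : `|z| < r -> geom_bounded a r ->
  quot a z n = a n.+1 + z * quot a z n.+1.
Proof.
move=> zr aB; have r0 : 0 < r by apply: le_lt_trans zr.
apply: has_psumE.
have := @has_psum_behead (fun j => a (n.+1 + j)%N) z (quot a z n.+1).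
rewrite addn0; apply.
under [X in has_psum X]eq_fun do rewrite addnS -addSn.
exact/(@geom_bounded_has_psum _ r)/zr/geom_bounded_drop.
Qed.

Lemma psum_behead a r z : `|z| < r -> geom_bounded a r ->
  psum a z = a 0%N + z * psum (fun n => a n.+1) z.
Proof.
move=> zr aB; have r0 : 0 < r by apply: le_lt_trans zr.
apply: has_psumE; apply: has_psum_behead.
exact/(@geom_bounded_has_psum _ r)/zr/(@geom_bounded_drop _ _ 1).
Qed.

(** By [quotS], [a n.+1] is [quot a z n - z * quot a z n.+1]; summing this against [x ^+ n] gives
    the factorisation without rearranging a double series. *)
Lemma psum_quot a r z x : `|z| < r -> `|x| < r -> geom_bounded a r ->
  psum a x = psum a z + (x - z) * psum (quot a z) x.
Proof.
move=> zr xr aB; have r0 : 0 < r by apply: le_lt_trans zr.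
have bB := @geom_bounded_quot _ _ _ zr aB.
have bxE := @psum_behead _ _ _ xr bB.
have xS := @geom_bounded_has_psum _ _ _ bB xr.
have bS := @geom_bounded_has_psum _ _ _ (@geom_bounded_drop _ _ 1 r0 bB) xr.
rewrite (@psum_behead _ _ _ xr aB) (@psum_behead _ _ _ zr aB).
have -> : psum (fun n => a n.+1) x =
    psum (quot a z) x - z * psum (fun n => quot a z n.+1) x.
  apply: has_psumE; rewrite -mulNr.
  have := @has_psumD _ _ _ _ _ xS (@has_psumZ _ _ _ (- z) bS).
  congr has_psum; apply/funext => n.
  by rewrite (@quotS _ _ _ _ zr aB) mulNr addrK.
rewrite bxE -/(quot a z 0%N); ring.
Qed.

End PowerSeries.

(** * Termwise differentiation *)

Definition pderiv (K : numFieldType) (a : nat -> K) (n : nat) : K :=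
  n.+1%:R * a n.+1.

(** Each of the [n.+1] powers [(q / p) ^+ i] with [i <= n] is at least [(q / p) ^+ n], and their sum
    is at most that of the full geometric series. *)
Lemma natr_geom_le (K : numFieldType) (q p : K) n : 0 <= q -> q < p ->
  n.+1%:R * q ^+ n <= p / (p - q) * p ^+ n.
Proof.
move=> q0 qp; have p0 : 0 < p by apply: le_lt_trans qp.
have pq : 0 < p - q by rewrite subr_gt0.
have x0 : 0 <= q / p by rewrite divr_ge0 // ltW.
have x1 : q / p < 1 by rewrite ltr_pdivrMr // mul1r.
have -> : p / (p - q) = 1 / (1 - q / p).
  by field; rewrite !gt_eqF.
have := sum_geom_le n.+1 ler01 x0 x1.
rewrite -ler_pdivrMr ?exprn_gt0 // -mulrA -expr_div_n; apply: le_trans.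
rewrite big_mkord mulr_natl -[X in _ *+ X]card_ord -sumr_const; apply: ler_sum => i _.
rewrite mul1r; apply: ler_wiXn2l => //; first exact: ltW.
by rewrite -ltnS.
Qed.

Section Differentiation.
Variables (K : numFieldType).
Implicit Types (a b : nat -> K) (r z l : K).

Lemma is_derive_quadratic (f : K -> K) z l d C : 0 < d ->
  (forall t, `|t| < d -> `|f (z + t) - f z - t * l| <= C * `|t| ^+ 2) ->
  is_derive z 1 f l.
Proof.
move=> d0 fC.
(* The bound tested at [t = d / 2] forces the sign of [C]. *)
have C0 : 0 <= C.
  have d2 : `|d / 2| = d / 2 by rewrite ger0_norm // divr_ge0 // ltW.
  have := fC (d / 2); rewrite d2 => /(_ _).
  rewrite ltr_pdivrMr // ltr_pMr // ltr1n => /(_ isT) /(le_trans (normr_ge0 _)).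
  by rewrite pmulr_lge0 // exprn_gt0 // divr_gt0.
have fl : h^-1 *: ((f \o shift z) (h *: 1) - f z) @[h --> 0^'] --> l.
  apply/cvgrPdist_lt => e e0.
  (* [C + 1] replaces [C], which may be 0, as a divisor. *)
  have e1 : 0 < e / (C + 1) by rewrite divr_gt0 // ltr_wpDl.
  have dr : d >=< e / (C + 1) by rewrite real_comparable // gtr0_real.
  exists (Num.min d (e / (C + 1))).
    by rewrite /= comparable_lt_min // d0.
  move=> t /=; rewrite sub0r normrN => td t0.
  have [td1 td2] : `|t| < d /\ `|t| < e / (C + 1).
    by move: td; rewrite comparable_lt_min // => /andP.
  rewrite /GRing.scale /= mulr1.
  have -> : l - t^-1 * (f (t + z) - f z) = - (t^-1 * (f (z + t) - f z - t * l)).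
    by rewrite [t + z]addrC; field.
  rewrite normrN normrM normfV ltr_pdivrMl ?normr_gt0 //.
  apply: le_lt_trans (fC t td1) _.
  rewrite expr2 mulrCA ltr_pM2l ?normr_gt0 //.
  apply: le_lt_trans (_ : (C + 1) * `|t| < e); last first.
    by rewrite mulrC -ltr_pdivlMr // ltr_wpDl.
  by rewrite ler_wpM2r // lerDl.
by apply: DeriveDef; [apply/cvg_ex; exists l|apply: cvg_lim fl].
Qed.

Hypothesis hK : geom_complete K.

Lemma geom_bounded_pderiv a r r' : 0 <= r' -> r' < r -> geom_bounded a r ->
  geom_bounded (pderiv a) r'.
Proof.
move=> r'0 r'r [C aC]; exists (r / (r - r') * (C / r)) => n.
have r0 : 0 < r by apply: le_lt_trans r'r.
rewrite normrM mulrAC normr_nat.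
apply: le_trans (ler_wpM2r (normr_ge0 _) (natr_geom_le n r'0 r'r)) _.
rewrite -[leLHS]mulrA ler_wpM2l //.
  by rewrite divr_ge0 ?subr_ge0 ?ltW.
by rewrite ler_pdivlMr // mulrAC -exprSr mulrC.
Qed.

(** Summation by parts: with [b = quot a z], the coefficient [a n.+1] is [b n - z * b n.+1], so the
    partial sums at [z] of [pderiv a] and of [b] differ by [N * b N * z ^+ N], which tends to 0. *)
Lemma has_psum_pderiv a r z : `|z| < r -> geom_bounded a r ->
  has_psum (pderiv a) z (psum (quot a z) z).
Proof.
move=> zr aB; have bB := geom_bounded_quot hK zr aB.
have bS := geom_bounded_has_psum hK bB zr.
have partE N : series (fun k => pderiv a k * z ^+ k) N =
    series (fun k => quot a z k * z ^+ k) N + - (N%:R * (quot a z N * z ^+ N)).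
  elim: N => [|N IH]; first by rewrite /series /= !big_nil mul0r subr0.
  rewrite /series /= !big_nat_recr //= -![\sum_(_ <= _ < _) _]/(series _ _) IH.
  rewrite /pderiv (quotS hK N zr aB) exprS -natr1; ring.
suff H : (fun n => n%:R * (quot a z n * z ^+ n)) @ \oo --> (0 : K).
  rewrite /has_psum -[psum _ _]subr0.
  have -> : series (fun k => pderiv a k * z ^+ k) =
      (fun N => series (fun k => quot a z k * z ^+ k) N
                - N%:R * (quot a z N * z ^+ N)).
    by apply/funext => N; rewrite partE.
  exact: cvgB.
have [C bC] := bB; have [q0 q1] := ratio_bounds zr.
(* Passing from the ratio [|z| / r] to a larger [p < 1] absorbs the factor [n]. *)
have [p [qp p1]] : exists p, `|z| / r < p /\ p < 1.
  by exists ((`|z| / r + 1) / 2); rewrite !midf_lt.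
have p0 : 0 <= p by apply: le_trans (ltW qp).
have := geom_cvg0 hK (C * (p / (p - `|z| / r))) p0 p1.
move=> /cvgrPdist_lt gc; apply/cvgrPdist_lt => e e0.
have := gc e e0; apply: filterS => n.
rewrite !sub0r !normrN; apply: le_lt_trans.
rewrite normrM normr_nat mulrC.
apply: le_trans (ler_wpM2r (ler0n K n) (norm_term_le zr (bC n))) _.
have C0 := geom_bounded_ge0 bC.
have pn : 0 <= p / (p - `|z| / r) by rewrite divr_ge0 // subr_ge0 ltW.
rewrite [leRHS]ger0_norm ?(mulr_ge0 (mulr_ge0 C0 pn)) ?exprn_ge0 //.
rewrite -!mulrA ler_wpM2l //.
rewrite [leRHS]mulrA; apply: le_trans (natr_geom_le n q0 qp).
by rewrite mulrC ler_wpM2r ?exprn_ge0 // ler_nat.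
Qed.

(** Dividing twice by [x - z] writes the Taylor remainder as [D * t ^+ 2], where [D] is a value of
    the second quotient. *)
Lemma is_derive_psum a r z : `|z| < r -> geom_bounded a r ->
  is_derive z 1 (psum a) (psum (pderiv a) z).
Proof.
move=> zr aB; rewrite (has_psumE (has_psum_pderiv zr aB)).
have bB := geom_bounded_quot hK zr aB.
have [C cC] := geom_bounded_quot hK zr bB.
(* Keeping [z + t] inside radius [s < r] bounds [D] uniformly in [t]. *)
have [s [zs sr]] : exists s, `|z| < s /\ s < r.
  by exists ((`|z| + r) / 2); rewrite !midf_lt.
have r0 : 0 < r by apply: le_lt_trans zr.
apply: (@is_derive_quadratic _ _ _ (s - `|z|) (C / (1 - s / r))).
  by rewrite subr_gt0.
move=> t ts.
have xs : `|z + t| < s.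
  by apply: le_lt_trans (ler_normD _ _) _; rewrite -ltrBrDl.
have xr := lt_trans xs sr.
rewrite (psum_quot hK zr xr aB) (psum_quot hK zr xr bB).
set A := psum _ _; set B := psum _ _; set D := psum _ _.
have -> : A + (z + t - z) * (B + (z + t - z) * D) - A - t * B = D * t ^+ 2 by ring.
rewrite normrM normrX ler_wpM2r ?exprn_ge0 //.
apply: le_trans (norm_psum_le hK cC xr) _.
rewrite ler_wpM2l ?(geom_bounded_ge0 cC) // lef_pV2 ?posrE ?subr_gt0 ?ltr_pdivrMr ?mul1r //.
by rewrite lerB // ler_wpM2r ?invr_ge0 ?(ltW r0) // ltW.
Qed.

End Differentiation.

Lemma is_derive_comp (K : numFieldType) (f h : K -> K) (x df dh : K) :
  is_derive x 1 f df -> is_derive (f x) 1 h dh ->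
  is_derive x 1 (h \o f) (dh * df).
Proof.
move=> [/derivable1_diffP df1 <-] [/derivable1_diffP dh1 <-].
have dhf : differentiable (h \o f) x by apply: differentiable_comp.
apply: DeriveDef; first exact/derivable1_diffP.
rewrite -!derive1E derive1E' // diff_comp // !derive1E' //=.
by rewrite -[X in 'd  _ _ X = _]mulr1 [LHS]linearZ mulrC.
Qed.

Lemma is_derive_horner (K : numFieldType) (p : {poly K}) (x : K) :
  is_derive x 1 (horner p) p^`().[x].
Proof.
elim/poly_ind: p => [|p c ih].
  have -> : horner 0 = cst (0 : K) by apply/funext => y; rewrite horner0.
  by apply: is_derive_eq; rewrite deriv0 horner0.
have -> : horner (p * 'X + c%:P) = (horner p : K -> K) * id + cst c.
  by apply/funext => y; rewrite !hornerE.
apply: is_derive_eq.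
rewrite derivD derivM derivX derivC !hornerE.
by rewrite /GRing.scale /= mulr1 addrC mulrC.
Qed.

(** * The identity theorem by Blaschke factors *)

Section Identity.
Variables (K : numClosedFieldType).
Hypothesis hK : geom_complete K.
Implicit Types (f c : nat -> K) (r z l : K).

(* Multiplication by the inverse Blaschke factor (1 - z^* x) / (x - z). *)
Definition blaschke f z n : K :=
  quot f z n - z^* * (if n is m.+1 then quot f z m else 0).

(** This is [f = (x - z) * quot f z] read off coefficientwise; the root condition enters through the
    constant term. *)
Lemma quot_root r f z n : `|z| < r -> geom_bounded f r -> psum f z = 0 ->
  f n = (if n is m.+1 then quot f z m else 0) - z * quot f z n.
Proof.
move=> zr fB fz; case: n => [|n]; last by rewrite (quotS hK n zr fB) addrK.
have := psum_behead hK zr fB; rewrite fz -/(quot f z 0%N) sub0r => /esym/eqP.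
by rewrite addr_eq0 => /eqP.
Qed.

Lemma geom_bounded_blaschke r f z : `|z| < r -> geom_bounded f r ->
  geom_bounded (blaschke f z) r.
Proof.
move=> zr fB; have [C bC] := geom_bounded_quot hK zr fB.
have r0 : 0 < r by apply: le_lt_trans zr.
have C0 := geom_bounded_ge0 bC.
exists (C + `|z| * r * C) => n.
apply: le_trans (ler_wpM2r (exprn_ge0 n (ltW r0)) (ler_normB _ _)) _.
rewrite mulrDl lerD // normrM norm_conjC -!mulrA ler_wpM2l //.
case: n => [|n]; first by rewrite normr0 mul0r mulr_ge0 // ltW.
by rewrite exprS mulrCA ler_wpM2l // ltW.
Qed.

Lemma psum_blaschke r f z x : `|z| < r -> `|x| < r -> x != z ->
  geom_bounded f r -> psum f z = 0 -> psum f x = 0 -> psum (blaschke f z) x = 0.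
Proof.
move=> zr xr xz fB fz fx.
have bS := geom_bounded_has_psum hK (geom_bounded_quot hK zr fB) xr.
have b0 : psum (quot f z) x = 0.
  have := psum_quot hK zr xr fB; rewrite fz fx add0r => /esym/eqP.
  by rewrite mulf_eq0 subr_eq0 (negPf xz) => /eqP.
have := has_psumD bS (has_psumZ (c := - z^*) (has_psum_shift bS)).
rewrite b0 mulr0 mulr0 addr0 => /has_psumE <-; congr psum.
by apply/funext => n; rewrite /blaschke mulNr.
Qed.

(** With [u = quot f z n] and [v] its predecessor, [f n = v - z * u] and
    [blaschke f z n = u - z^* * v]. The cross terms of the squared moduli agree, leaving
    [(1 - |z|^2) * (|u|^2 - |v|^2)], which telescopes. *)
Lemma blaschke_energy r f z N : `|z| < r -> geom_bounded f r -> psum f z = 0 ->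
  \sum_(i < N.+1) `|blaschke f z i| ^+ 2 =
  \sum_(i < N.+1) `|f i| ^+ 2 + (1 - `|z| ^+ 2) * `|quot f z N| ^+ 2.
Proof.
move=> zr fB fz.
have E n : `|blaschke f z n| ^+ 2 = `|f n| ^+ 2 + (1 - `|z| ^+ 2) *
    (`|quot f z n| ^+ 2 - `|if n is m.+1 then quot f z m else 0| ^+ 2).
  rewrite (quot_root n zr fB fz) /blaschke.
  move: (quot _ _ _) (if n is m.+1 then _ else _) => u v.
  rewrite !normCK !(rmorphB, rmorphM) /= conjCK; ring.
elim: N => [|N IH]; first by rewrite !big_ord1 E normr0 expr0n subr0.
by rewrite big_ord_recr /= IH [X in _ = X + _]big_ord_recr /= E; ring.
Qed.

(** The boundary term of [blaschke_energy] tends to 0 because [r > 1], while partial sums of squares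
    increase; a partial sum above [M] would stay above it by a fixed amount. *)
Lemma blaschke_energy_le r f z M : 1 < r -> `|z| < 1 -> geom_bounded f r ->
  psum f z = 0 -> (forall N, \sum_(i < N) `|f i| ^+ 2 <= M) ->
  forall N, \sum_(i < N) `|blaschke f z i| ^+ 2 <= M.
Proof.
move=> r1 z1 fB fz fM N; have zr := lt_trans z1 r1.
have r0 : 0 < r by apply: lt_trans r1.
have M0 : 0 <= M by have := fM 0%N; rewrite big_ord0.
have S0 : 0 <= \sum_(i < N) `|blaschke f z i| ^+ 2.
  by apply: sumr_ge0 => i _; rewrite exprn_ge0.
rewrite real_leNgt ?ger0_real //; apply/negP => lt_M.
have [C bC] := geom_bounded_quot hK zr fB; have C0 := geom_bounded_ge0 bC.
have q0 : 0 <= r^-1 ^+ 2 by rewrite exprn_ge0 // invr_ge0 ltW.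
have q1 : r^-1 ^+ 2 < 1 by rewrite exprn_ilt1 ?invf_lt1 // invr_ge0 ltW.
have := geom_cvg0 hK (C ^+ 2) q0 q1 => /cvgrPdist_lt /(_ _ (_ : 0 < _ - M)).
move=> /(_ (\sum_(i < N) `|blaschke f z i| ^+ 2)); rewrite subr_gt0 => /(_ lt_M).
(* The index [n0 + N] lies past the threshold for the boundary term and also past the offending
   partial sum. *)
case=> n0 _ /(_ (n0 + N)%N (leq_addr _ _)) /=; apply/negP.
rewrite le_gtF // sub0r normrN ger0_norm ?mulr_ge0 ?exprn_ge0 ?invr_ge0 ?(ltW r0) //.
rewrite lerBlDl.
have /le_trans -> // : \sum_(i < N) `|blaschke f z i| ^+ 2 <=
    \sum_(i < (n0 + N).+1) `|blaschke f z i| ^+ 2.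
  rewrite -(big_mkord xpredT (fun i => `|blaschke f z i| ^+ 2)).
  rewrite -(big_mkord xpredT (fun i => `|blaschke f z i| ^+ 2)).
  rewrite (@big_cat_nat _ _ _ N 0 (n0 + N).+1) //=; last by rewrite leqW ?leq_addl.
  by rewrite lerDl sumr_ge0 // => i _; rewrite exprn_ge0.
rewrite (blaschke_energy _ zr fB fz) lerD //.
apply: le_trans (_ : `|quot f z (n0 + N)| ^+ 2 <= _).
  by rewrite ler_piMl ?exprn_ge0 // gerBl exprn_ge0.
rewrite -exprM mulnC exprM -exprMn; apply: lerXn2r; rewrite ?nnegrE //.
  by rewrite mulr_ge0 ?exprn_ge0 // invr_ge0 ltW.
by rewrite exprVn ler_pdivlMr ?exprn_gt0.
Qed.

(** Removing the root [z] turns [f 0] into [quot f z 0], and [f 0 = - z * quot f z 0]; each root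
    thus costs a factor [|z|^2 <= q^2] while the energy bound [M] persists. *)
Lemma coef0_roots_le r f M q (s : seq K) : 1 < r -> q < 1 ->
  geom_bounded f r -> (forall N, \sum_(i < N) `|f i| ^+ 2 <= M) ->
  uniq s -> (forall z, z \in s -> `|z| <= q /\ psum f z = 0) ->
  `|f 0%N| ^+ 2 <= M * (q ^+ 2) ^+ size s.
Proof.
move=> r1 q1; elim: s f => [|z s IH] f fB fM.
  by move=> _ _; have := fM 1%N; rewrite big_ord1 mulr1.
rewrite cons_uniq => /andP[zs us] fs.
have [zq fz] := fs z (mem_head _ _); have z1 := le_lt_trans zq q1.
have q0 : 0 <= q by apply: le_trans zq.
have zr := lt_trans z1 r1.
rewrite (quot_root 0 zr fB fz) sub0r normrN normrM exprMn /= [X in M * X]exprSr.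
rewrite mulrA mulrC; apply: ler_pM; rewrite ?exprn_ge0 //; last first.
  by apply: lerXn2r; rewrite ?nnegrE.
have := IH (blaschke f z) (geom_bounded_blaschke zr fB)
  (blaschke_energy_le r1 z1 fB fz fM) us.
rewrite /blaschke mulr0 subr0; apply => x xs.
have [xq fx] := fs x (@mem_behead _ (z :: s) x xs).
have xr : `|x| < r by apply: le_lt_trans xq (lt_trans q1 r1).
split=> //; apply: (psum_blaschke zr xr) => //.
by apply: contraNneq zs => <-.
Qed.

Lemma energy_bounded r f : 1 < r -> geom_bounded f r ->
  exists M, forall N, \sum_(i < N) `|f i| ^+ 2 <= M.
Proof.
move=> r1 [C fC]; have C0 := geom_bounded_ge0 fC.
have r0 : 0 < r by apply: lt_trans r1.
have q0 : 0 <= r^-1 ^+ 2 by rewrite exprn_ge0 // invr_ge0 ltW.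
have q1 : r^-1 ^+ 2 < 1 by rewrite exprn_ilt1 ?invf_lt1 // invr_ge0 ltW.
exists (C ^+ 2 / (1 - r^-1 ^+ 2)) => N.
apply: le_trans (sum_geom_le N (exprn_ge0 2 C0) q0 q1).
rewrite big_mkord; apply: ler_sum => i _.
rewrite -exprM mulnC exprM -exprMn; apply: lerXn2r; rewrite ?nnegrE //.
  by rewrite mulr_ge0 ?exprn_ge0 // invr_ge0 ltW.
by rewrite exprVn ler_pdivlMr ?exprn_gt0.
Qed.

Lemma coef0_eq0 r q f : 1 < r -> q < 1 -> geom_bounded f r ->
  (forall k, exists s : seq K, [/\ uniq s, size s = k &
     forall z, z \in s -> `|z| <= q /\ psum f z = 0]) ->
  f 0%N = 0.
Proof.
move=> r1 q1 fB fs.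
(* A list of one root exhibits a norm below [q]. *)
have q0 : 0 <= q.
  have [[|z s] [_ // _ /(_ z (mem_head _ _)) [zq _]]] := fs 1%N.
  exact: le_trans zq.
have [M fM] := energy_bounded r1 fB.
have qq1 : q ^+ 2 < 1 by rewrite exprn_ilt1.
apply/eqP; rewrite -normr_eq0 -sqrf_eq0; apply/negPn/negP => f0.
have e0 : 0 < `|f 0%N| ^+ 2 by rewrite lt_def f0 exprn_ge0.
have := geom_cvg0 hK M (exprn_ge0 2 q0) qq1 => /cvgrPdist_lt /(_ _ e0).
case=> N _ /(_ N (leqnn N)) /=; apply/negP; rewrite le_gtF //.
have [s [us <- sP]] := fs N.
have M0 : 0 <= M by have := fM 0%N; rewrite big_ord0.
rewrite sub0r normrN [leRHS]ger0_norm ?mulr_ge0 ?exprn_ge0 //.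
exact: (coef0_roots_le r1 q1 fB fM us sP).
Qed.

(** Once [f 0 = 0], the series [f / x] vanishes at the same points, since these are nonzero;
    induction then reaches every coefficient. *)
Lemma identity_unit_disc r q f : 1 < r -> q < 1 -> geom_bounded f r ->
  (forall k, exists s : seq K, [/\ uniq s, size s = k &
     forall z, z \in s -> [/\ z != 0, `|z| <= q & psum f z = 0]]) ->
  forall n, f n = 0.
Proof.
move=> r1 q1 fB fs n; elim: n f fB fs => [|n IH] f fB fs.
  apply: (coef0_eq0 r1 q1 fB) => k; have [s [us sk sP]] := fs k.
  by exists s; split => // z /sP[].
have f0 : f 0%N = 0.
  apply: (coef0_eq0 r1 q1 fB) => k; have [s [us sk sP]] := fs k.
  by exists s; split => // z /sP[].
apply: (IH (fun n => f n.+1)).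
  exact: (geom_bounded_drop 1 (lt_trans ltr01 r1) fB).
move=> k; have [s [us sk sP]] := fs k; exists s; split => // z zs.
have [z0 zq fz] := sP z zs; split => //.
have zr : `|z| < r by apply: le_lt_trans zq (lt_trans q1 r1).
have := psum_behead hK zr fB; rewrite fz f0 add0r => /esym/eqP.
by rewrite mulf_eq0 (negPf z0) => /eqP.
Qed.

Lemma power_series_identity r q c : q < r -> geom_bounded c r ->
  (forall k, exists s : seq K, [/\ uniq s, size s = k &
     forall z, z \in s -> [/\ z != 0, `|z| <= q & psum c z = 0]]) ->
  forall n, c n = 0.
Proof.
move=> qr [C cC] cs n.
have q0 : 0 <= q.
  have [[|z s] [_ // _ /(_ z (mem_head _ _)) [_ zq _]]] := cs 1%N.
  exact: le_trans zq.
(* Scaling by [t] between [q] and [r] puts the roots in radius [q / t < 1] and the coefficient bound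
   at [r / t > 1]. *)
have [t [qt tr]] : exists t, q < t /\ t < r.
  by exists ((q + r) / 2); rewrite !midf_lt.
have t0 : 0 < t by apply: le_lt_trans qt.
have tn0 : t != 0 by rewrite gt_eqF.
suff /eqP : c n * t ^+ n = 0.
  by rewrite mulf_eq0 expf_eq0 (negPf tn0) andbF orbF => /eqP.
apply: (@identity_unit_disc (r / t) (q / t) (fun n => c n * t ^+ n)).
- by rewrite ltr_pdivlMr // mul1r.
- by rewrite ltr_pdivrMr // mul1r.
- exists C => m; rewrite normrM [`|t ^+ m|]ger0_norm ?exprn_ge0 ?(ltW t0) //.
  by rewrite -mulrA -exprMn mulrCA divff // mulr1.
move=> k; have [s [us sk sP]] := cs k.
exists [seq z / t | z <- s]; split.
- by rewrite map_inj_uniq //; apply: mulIf; rewrite invr_eq0.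
- by rewrite size_map.
move=> _ /mapP[z /sP[z0 zq cz] ->]; split.
- by rewrite mulf_neq0 ?invr_eq0.
- by rewrite normrM normfV (ger0_norm (ltW t0)) ler_wpM2r ?invr_ge0 ?(ltW t0).
rewrite -[RHS]cz /psum; congr (limn (series _)).
by apply/funext => m; rewrite -mulrA -exprMn mulrCA divff // mulr1.
Qed.

End Identity.

(** * The differential equation *)

(** The exponential enters only through [E' = E]. No step divides by [h], so zeros of [p] in [U] are
    harmless. *)
Lemma exp_sqrt_ode (K : numFieldType) (E f f1 f2 h h' : K -> K)
    (w p : {poly K}) (e : K) (U : set K) :
  open U -> e = 1 \/ e = -1 ->
  (forall x : K, is_derive x 1 E (E x)) ->
  (forall z, U z -> is_derive z 1 h (h' z)) ->
  (forall z, U z -> h z ^+ 2 = p.[z]) ->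
  (forall z, U z -> is_derive z 1 f (f1 z)) ->
  (forall z, U z -> is_derive z 1 f1 (f2 z)) ->
  (forall z, U z -> f z = E (w.[z] + e * h z)) ->
  forall z, U z ->
  (- (e *: (4 * p^`() * p))).[z] * f2 z
  + (e *: (2 * (2 * p^`(2) * p - p^`() ^+ 2 + 4 * w^`() * p^`() * p))).[z] * f1 z
  + (e *: (4 * p^`() * p * w^`(2) - 4 * p^`() * p * w^`() ^+ 2 + p^`() ^+ 3
        - 4 * w^`() * p^`(2) * p + 2 * w^`() * p^`() ^+ 2)).[z] * f z = 0.
Proof.
move=> oU he dE dh hp df df1 fE.
have nU z : U z -> nbhs z U by move=> Uz; apply: open_nbhs_nbhs.
have is_derive_uniq (g k : K -> K) z a b : U z -> (forall x, U x -> g x = k x) ->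
    is_derive z 1 g a -> is_derive z 1 k b -> a = b.
  move=> Uz gk ga kb; rewrite -(@derive_val _ _ _ _ _ _ _ ga).
  rewrite -(@derive_val _ _ _ _ _ _ _ kb); apply: near_eq_derive.
  by have := nU z Uz; apply: filterS => x Ux; apply: gk.
have dhp z : U z -> p^`().[z] = 2 * h z * h' z.
  move=> Uz; have dhz := dh z Uz.
  have := is_derive_uniq _ _ z _ _ Uz _ (is_derive_horner p z) (is_deriveM dhz dhz).
  move=> ->; first by rewrite /GRing.scale /=; ring.
  by move=> x Ux; rewrite -hp // expr2.
have f1E z : U z -> f1 z = (w^`().[z] + e * h' z) * f z.
  move=> Uz; rewrite fE // mulrC.
  apply: (is_derive_uniq f (E \o (horner w + e \*: h)) z _ _ Uz) => //; last first.
    apply: is_derive_comp (dE _).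
    by have := dh z Uz; have := is_derive_horner w z => ? ?; apply: is_deriveD.
  exact: df.
(* [F] is the difference of the two sides of [2 p y = e p' h f], with [y = f1 - w' f]; [D] below
   says that its derivative vanishes. *)
pose F : K -> K := cst 2 * horner p * (f1 - horner w^`() * f)
  - (e \*: (horner p^`() * (h * f))).
have F0 x : U x -> F x = cst 0 x.
  move=> Ux.
  change (2 * p.[x] * (f1 x - w^`().[x] * f x) - e * (p^`().[x] * (h x * f x)) = 0).
  rewrite f1E // -hp // dhp //.
  ring.
move=> z Uz.
have dhz := dh z Uz; have dfz := df z Uz; have df1z := df1 z Uz.
have wz := is_derive_horner w^`() z.
have pz := is_deriveM (is_derive_cst (2 : K) z 1) (is_derive_horner p z).
have p1z := is_derive_horner p^`() z.
have D : 2 * p.[z] * (f2 z - (w^`().[z] * f1 z + f z * w^`()^`().[z]))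
    + (f1 z - w^`().[z] * f z) * (2 * p^`().[z] + p.[z] * 0)
    - e * (p^`().[z] * (h z * f1 z + f z * h' z) + h z * f z * p^`()^`().[z]) = 0.
  apply: (is_derive_uniq _ _ z _ _ Uz F0) (is_derive_cst _ _ _).
  exact: (is_deriveB (is_deriveM pz (is_deriveB df1z (is_deriveM wz dfz)))
    (is_deriveZ e (is_deriveM p1z (is_deriveM dhz dfz)))).
(* Modulo f1E, dhp and hp, the equation is - 4 e h h' times D. *)
rewrite -[RHS](mulr0 (- 4 * e * h z * h' z)) -[in RHS]D.
rewrite !derivSn !derivn0.
rewrite !(hornerD, hornerN, hornerM, hornerZ, horner_exp, hornerC).
rewrite f1E // !dhp // -!hp //.
by case: he => ->; ring.
Qed.

(** * From the differential equation to the coefficients *)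

Definition pmul (K : numFieldType) (p : {poly K}) (a : nat -> K) (n : nat) : K :=
  \sum_(0 <= j < n.+1) p`_j * a (n - j)%N.

(** Induction on the Horner form: multiplication by ['X] is a shift, and the constant term a
    scaling. *)
Lemma has_psum_pmul (K : numFieldType) (p : {poly K}) (a : nat -> K) z l :
  has_psum a z l -> has_psum (pmul p a) z (p.[z] * l).
Proof.
move=> al; elim/poly_ind: p => [|p c IH].
  have := has_psumZ (c := 0) al; rewrite horner0; congr has_psum.
  apply/funext => n; rewrite mul0r /pmul big1 // => j _.
  by rewrite coef0 mul0r.
have := has_psumD (has_psum_shift IH) (has_psumZ (c := c) al).
rewrite hornerMXaddC mulrDl mulrA [z * _]mulrC; congr has_psum.
apply/funext => n; rewrite /pmul big_nat_recl // coefD coefMX coefC /= add0r subn0.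
rewrite addrC; congr (_ + _); case: n => [|n]; first by rewrite big_geq.
apply: eq_bigr => j _.
by rewrite coefD coefMX coefC /= addr0 subSS.
Qed.

Lemma has_psum_geom_bounded (K : numFieldType) (a : nat -> K) z l :
  has_psum a z l -> geom_bounded a `|z|.
Proof.
move=> /cvgP/cvg_series_cvg_0 /cvgP/cvg_seq_bounded [M [Mr aM]].
exists (M + 1) => n; rewrite -normrX -normrM.
by apply: aM => //; rewrite ltrDl.
Qed.

Lemma nbhs_roots (K : numFieldType) (A : set K) (z : K) (k : nat) :
  nbhs z A -> exists s : seq K, [/\ uniq s, size s = k &
    forall x, x \in s -> x != 0 /\ A x].
Proof.
move=> /nbhs_ballP[d /= d0 dA].
(* The offset [i + 2] keeps these distinct points strictly inside the ball. There are [k + 1] of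
   them, as one may be 0 and is then discarded. *)
pose t := [seq z + d / i.+2%:R | i <- iota 0 k.+1].
have ut : uniq t.
  rewrite map_inj_uniq ?iota_uniq // => i j /addrI /(mulfI _).
  by rewrite gt_eqF // => /(_ isT)/invr_inj/eqP; rewrite eqr_nat => /eqP[].
have tA x : x \in t -> A x.
  move=> /mapP[i _ ->]; apply: dA; rewrite -ball_normE /= opprD addrA subrr sub0r.
  rewrite normrN ger0_norm ?divr_ge0 ?(ltW d0) // ltr_pdivrMr ?ltr0n //.
  by rewrite ltr_pMr // ltr1n.
pose u := [seq x <- t | x != 0].
have ku : (k <= size u)%N.
  have := count_predC (pred1 0) t.
  rewrite size_map size_iota count_uniq_mem // size_filter -ltnS => <-.
  by rewrite -add1n leq_add ?leq_b1.
exists (take k u); split; first by rewrite take_uniq // filter_uniq.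
  by rewrite size_takel.
by move=> x /mem_take; rewrite mem_filter => /andP[/= x0 /tA].
Qed.

Section Recurrence.
Variables (K : numClosedFieldType) (T R Q : {poly K}) (g : nat -> K).
Hypothesis hK : geom_complete K.

(** The factors [n (n - 1) g n] and [n g n] are the coefficients of [x^2 g''] and [x g']; the
    remaining powers of [x] are attached to [R] and [Q]. *)
Definition ode_coef (n : nat) : K :=
  pmul T (fun n => n%:R * (n%:R - 1) * g n) n
  + pmul ('X * R) (fun n => n%:R * g n) n + pmul ('X^2 * Q) g n.

Lemma has_psum_ode_coef r z : geom_bounded g r -> `|z| < r ->
  has_psum ode_coef z (z ^+ 2 * (T.[z] * psum (pderiv (pderiv g)) z
    + R.[z] * psum (pderiv g) z + Q.[z] * psum g z)).
Proof.
move=> gB zr.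
(* Each of the two differentiations costs some radius, hence [|z| < t < s < r]. *)
have [s [zs sr]] : exists s, `|z| < s /\ s < r.
  by exists ((`|z| + r) / 2); rewrite !midf_lt.
have [t [zt ts]] : exists t, `|z| < t /\ t < s.
  by exists ((`|z| + s) / 2); rewrite !midf_lt.
have t0 : 0 <= t by apply: le_trans (ltW zt).
have s0 : 0 <= s by apply: le_trans (ltW zs).
have g1B := geom_bounded_pderiv s0 sr gB.
have g2B := geom_bounded_pderiv t0 ts g1B.
have S0 := geom_bounded_has_psum hK gB zr.
have S1 := has_psum_shift (geom_bounded_has_psum hK g1B zs).
have S2 := has_psum_shift (has_psum_shift (geom_bounded_has_psum hK g2B zt)).
have E1 : (fun n => if n is m.+1 then pderiv g m else 0) = (fun n => n%:R * g n).
  by apply/funext => -[|n] //; rewrite mul0r.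
have E2 : (fun n => if n is m.+1 then
      if m is m'.+1 then pderiv (pderiv g) m' else 0 else 0) =
    (fun n => n%:R * (n%:R - 1) * g n).
  apply/funext => -[|[|n]]; rewrite ?mul0r ?subrr ?mulr0 ?mul0r //.
  by rewrite /pderiv -[in n.+2%:R - 1]natr1 addrK mulrA [n.+1%:R * _]mulrC.
rewrite E1 in S1; rewrite E2 in S2.
have := has_psumD (has_psumD (has_psum_pmul (p := T) S2) (has_psum_pmul (p := 'X * R) S1))
  (has_psum_pmul (p := 'X^2 * Q) S0).
rewrite !hornerM !hornerX; congr has_psum; ring.
Qed.

Lemma ode_coef_eq0 r z0 (U : set K) : geom_bounded g r -> `|z0| < r ->
  nbhs z0 U ->
  (forall z, U z -> `|z| < r -> T.[z] * psum (pderiv (pderiv g)) z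
    + R.[z] * psum (pderiv g) z + Q.[z] * psum g z = 0) ->
  forall n, ode_coef n = 0.
Proof.
move=> gB zr Uz0 ode.
(* [s] will bound the moduli of the zeros, and [t] will be the radius of the coefficient bound. *)
have [s [zs sr]] : exists s, `|z0| < s /\ s < r.
  by exists ((`|z0| + r) / 2); rewrite !midf_lt.
have [t [st tr]] : exists t, s < t /\ t < r.
  by exists ((s + r) / 2); rewrite !midf_lt.
have t0 : 0 <= t by rewrite (le_trans _ (ltW st)) // (le_trans _ (ltW zs)).
(* Convergence at the point [t] itself bounds the terms there. *)
have cB : geom_bounded ode_coef t.
  rewrite -(ger0_norm t0).
  apply: has_psum_geom_bounded (has_psum_ode_coef gB _).
  by rewrite ger0_norm.
apply: (power_series_identity hK st cB) => k.
have Vz0 : nbhs z0 (U `&` [set z | `|z| < s]).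
  apply: filterI => //.
  apply/nbhs_ballP; exists (s - `|z0|); rewrite /= ?subr_gt0 // => x /=.
  rewrite -ball_normE /= ltrBrDl; apply: le_lt_trans.
  by rewrite -{1}(subrKC z0 x) (le_trans (ler_normD _ _)) // distrC.
have [u [uu uk uP]] := nbhs_roots k Vz0.
exists u; split => // z /uP[z0' [Uz zs']]; split => //; first exact: ltW.
have zr' : `|z| < r by apply: lt_trans sr.
by rewrite (has_psumE (has_psum_ode_coef gB zr')) ode // mulr0.
Qed.

End Recurrence.

Lemma cvgn_eps (K : numFieldType) (u : nat -> K) (l : K) :
  (forall e, 0 < e -> exists N, forall n, (N <= n)%N -> `|l - u n| < e) -> cvgn u.
Proof.
move=> ul; apply: (cvgP l); apply/cvgrPdist_lt => e /ul[N NP].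
by exists N => // n; apply: NP.
Qed.

Lemma is_derive_psum_exp (K : numFieldType) (x : K) : geom_complete K ->
  (forall r : K, geom_bounded (fun k => (k`!%:R)^-1 : K) `|r|) ->
  is_derive x 1 (psum (fun k => (k`!%:R)^-1)) (psum (fun k => (k`!%:R)^-1) x).
Proof.
move=> hK expB; pose a k : K := (k`!%:R)^-1.
have r1 : 0 <= `|x| + 1 by rewrite addr_ge0.
have aB : geom_bounded a (`|x| + 1) by rewrite -(ger0_norm r1); apply: expB.
have xr : `|x| < `|x| + 1 by rewrite ltrDl.
have := is_derive_psum hK xr aB.
have -> // : pderiv a = a.
apply/funext => n; rewrite /pderiv /a factS natrM invfM mulrA divff ?mul1r //.
Qed.

(** * The complex numbers over a [realType] *)

Section ComplexField.
Variable R : realType.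
Local Notation C := R[i].

Lemma normc_real (a : C) : `|a| = (complex.Re `|a|)%:C%C.
Proof. by rewrite RRe_real ?normr_real. Qed.

Lemma normc_le_Re_Im (a : C) :
  complex.Re `|a| <= `|complex.Re a| + `|complex.Im a|.
Proof.
rewrite normc_def /= -[leRHS]ger0_norm ?addr_ge0 // -sqrtr_sqr ler_wsqrtr //.
rewrite sqrrD !real_normK ?num_real // -addrA lerD2l lerDr.
by rewrite mulrn_wge0 // mulr_ge0.
Qed.

Lemma Re_le_normc (a : C) : `|complex.Re a| <= complex.Re `|a|.
Proof. by rewrite normc_def /= -sqrtr_sqr ler_wsqrtr // lerDl sqr_ge0. Qed.

Lemma Im_le_normc (a : C) : `|complex.Im a| <= complex.Re `|a|.
Proof.
by rewrite normc_def /= -sqrtr_sqr ler_wsqrtr // lerDr sqr_ge0.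
Qed.

Lemma geom_complete_real (u : nat -> R) (c q : R) : 0 <= q -> q < 1 ->
  (forall n, `|u n| <= c * q ^+ n) -> cvgn (series u).
Proof.
move=> q0 q1 uc; apply: (@normed_cvg _ R^o).
have uc0 n : 0 <= geometric c q n by apply: le_trans (uc n).
apply: (series_le_cvg _ uc0 uc) => //.
by apply: is_cvg_geometric_series; rewrite ger0_norm.
Qed.

(** Real and imaginary parts are dominated by the same real geometric sequence, so both series
    converge by comparison. *)
Lemma geom_complete_complex : geom_complete C.
Proof.
move=> u c q q0 q1 uc.
have qr : q = (complex.Re q)%:C%C by rewrite RRe_real ?ger0_real.
have c0 : 0 <= c by have := uc 0%N; rewrite expr0 mulr1; apply: le_trans.
have cr : c = (complex.Re c)%:C%C by rewrite RRe_real ?ger0_real.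
have Q0 : 0 <= complex.Re q by rewrite -ler0c -qr.
have Q1 : complex.Re q < 1 by rewrite -ltcR -qr.
have U n : complex.Re `|u n| <= complex.Re c * complex.Re q ^+ n.
  by rewrite -lecR -normc_real rmorphM rmorphXn /= -cr -qr.
have /cvg_ex[/= x xP] : cvgn (series (fun n => complex.Re (u n))).
  by apply: (geom_complete_real Q0 Q1) => n; apply: le_trans (U n); apply: Re_le_normc.
have /cvg_ex[/= y yP] : cvgn (series (fun n => complex.Im (u n))).
  by apply: (geom_complete_real Q0 Q1) => n; apply: le_trans (U n); apply: Im_le_normc.
apply: (@cvgn_eps C _ (x +i* y)%C) => e e0.
have er : e = (complex.Re e)%:C%C by rewrite RRe_real ?gtr0_real.
have e2 : 0 < complex.Re e / 2 by rewrite divr_gt0 // -ltcR -er.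
move/cvgrPdist_lt : xP => /(_ _ e2) [N1 _ N1P].
move/cvgrPdist_lt : yP => /(_ _ e2) [N2 _ N2P].
exists (maxn N1 N2) => n; rewrite geq_max => /andP[n1 n2].
rewrite er normc_real ltcR; apply: le_lt_trans (normc_le_Re_Im _) _.
rewrite [ltRHS]splitr; have := ltrD (N1P n n1) (N2P n n2).
have ReS : complex.Re (series u n) = series (fun n => complex.Re (u n)) n.
  by rewrite /series /= raddf_sum.
have ImS : complex.Im (series u n) = series (fun n => complex.Im (u n)) n.
  by rewrite /series /= raddf_sum.
rewrite -ReS -ImS; case: (series u n) => a b /=.
done.
Qed.

(** The real exponential series converges at [|r|], so its terms are bounded. *)
Lemma geom_bounded_exp (r : C) : geom_bounded (fun k => (k`!%:R)^-1 : C) `|r|.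
Proof.
have /cvg_seq_bounded[M [Mr aM]] :=
  cvgP _ (cvg_series_cvg_0 (is_cvg_series_exp_coeff (complex.Re `|r|))).
exists (M + 1)%:C%C => n.
rewrite [`|r|]normc_real normfV normr_nat -rmorphXn /=.
have -> : n`!%:R = (n`!%:R : R)%:C%C :> C by rewrite rmorph_nat.
rewrite -fmorphV -rmorphM /= lecR mulrC.
have := aM (M + 1); rewrite ltrDl ltr01 => /(_ isT n I).
by apply: le_trans; apply: ler_norm.
Qed.

(** Below the supremum there is room for a convergence point [z1] with [|z| < |z1|]; boundedness of
    the terms at [z1] gives [r = |z1|]. *)
Lemma cvg_disc_geom_bounded (g : nat -> C) (z : C) :
  (cvg_disc g : set C) z -> exists r, `|z| < r /\ geom_bounded g r.
Proof.
move=> /ereal_sup_gt[_ [z1 z1P <-]]; rewrite lte_fin => zz1.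
exists `|z1 : C|; split; first by rewrite [X in X < _]normc_real [X in _ < X]normc_real ltcR.
have : has_psum g (z1 : C) (limn (cpseries g z1)) by exact: z1P.
exact: has_psum_geom_bounded.
Qed.

End ComplexField.

(** * The recurrence *)

(** Extension by zero to negative indices matches multiplication by ['X] and ['X^2], whose low
    coefficients vanish. *)
Lemma recurrence_sumE (K : numClosedFieldType) (T R Q : {poly K}) (g : nat -> K) n :
  \sum_(0 <= j < n.+1)
     (((n%:Z - j%:Z) * (n%:Z - j%:Z - 1))%:~R * zcoef (nth 0 T) j%:Z
      + (n%:Z - j%:Z)%:~R * zcoef (nth 0 R) (j%:Z - 1)
      + zcoef (nth 0 Q) (j%:Z - 2))
     * zcoef g (n%:Z - j%:Z) = ode_coef T R Q g n.
Proof.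
rewrite /ode_coef /pmul -!big_split /=; apply: eq_big_nat => j /andP[_].
(* Writing [n = j + m] makes natural and integer subtraction agree. *)
rewrite ltnS => jn; rewrite -(subnKC jn); move: (n - j)%N => m {jn}.
have -> : (j + m)%:Z - j%:Z = m%:Z by rewrite PoszD addrAC subrr add0r.
rewrite addnC addnK /=.
have -> : zcoef (nth 0 R) (j%:Z - 1) = ('X * R)`_j.
  by rewrite coefXM; case: j => [|j] //=; rewrite subn1.
have -> : zcoef (nth 0 Q) (j%:Z - 2) = ('X^2 * Q)`_j.
  by rewrite coefXnM; case: j => [|[|j]] //=; rewrite subn2.
by rewrite intrM intrB -!pmulrn; ring.
Qed.

Lemma exp_sqrt_recurrence (K : numClosedFieldType) (w p : {poly K}) (e : K)
    (g : nat -> K) (r z0 : K) (U : set K) (h h' : K -> K) :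
  geom_complete K -> (forall r : K, geom_bounded (fun k => (k`!%:R)^-1 : K) `|r|) ->
  e = 1 \/ e = -1 -> geom_bounded g r -> `|z0| < r -> U z0 -> open U ->
  (forall z, U z -> is_derive z 1 h (h' z)) ->
  (forall z, U z -> h z ^+ 2 = p.[z]) ->
  (forall z, U z -> psum g z = psum (fun k => (k`!%:R)^-1) (w.[z] + e * h z)) ->
  forall n, ode_coef (- (e *: (4 * p^`() * p)))
    (e *: (2 * (2 * p^`(2) * p - p^`() ^+ 2 + 4 * w^`() * p^`() * p)))
    (e *: (4 * p^`() * p * w^`(2) - 4 * p^`() * p * w^`() ^+ 2 + p^`() ^+ 3
        - 4 * w^`() * p^`(2) * p + 2 * w^`() * p^`() ^+ 2)) g n = 0.
Proof.
move=> hK expB he gB zr Uz0 oU dh hp gE.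
(* The differential equation is used on the part of [U] inside radius [r], where [g] can be
   differentiated termwise. *)
have oV : open (U `&` ball 0 r).
  by apply: openI oU (ball_open _ _); apply: le_lt_trans zr.
have inV z : (U `&` ball 0 r) z -> U z /\ `|z| < r.
  by case=> Uz; rewrite -ball_normE /= sub0r normrN.
apply: (ode_coef_eq0 hK gB zr).
  by apply: open_nbhs_nbhs; split; [exact: oU|exact: Uz0].
move=> z Uz zr'.
apply: (@exp_sqrt_ode K (psum (fun k => (k`!%:R)^-1)) (psum g) _ _ h h' w p e
  (U `&` ball 0 r)) => //.
- by move=> x; apply: is_derive_psum_exp.
- by move=> x /inV[/dh].
- by move=> x /inV[/hp].
- by move=> x /inV[_ xr]; apply: is_derive_psum xr gB.
- move=> x /inV[_ xr].
  have [s [xs sr]] : exists s, `|x| < s /\ s < r.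
    by exists ((`|x| + r) / 2); rewrite !midf_lt.
  have s0 : 0 <= s by apply: le_trans (ltW xs).
  exact: is_derive_psum xs (geom_bounded_pderiv s0 sr gB).
- by move=> x /inV[/gE].
by split => //; rewrite -ball_normE /= sub0r normrN.
Qed.

Unset Implicit Arguments.

(* The terms with j > n vanish, since then zcoef g (n - j) = 0. *)
Theorem theorem7 (R : realType) (w p : {poly R[i]}) (e : R[i])
    (he : e = 1 \/ e = -1) (g : nat -> R[i])
    (hg : is_expansion_exp_sqrt e w p g) (n : nat) :
  \sum_(0 <= j < n.+1)
     (((n%:Z - j%:Z) * (n%:Z - j%:Z - 1))%:~R * zcoef (nth 0 (polyT e p)) j%:Z
      + (n%:Z - j%:Z)%:~R * zcoef (nth 0 (polyR e w p)) (j%:Z - 1)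
      + zcoef (nth 0 (polyQ e w p)) (j%:Z - 2))
     * zcoef g (n%:Z - j%:Z) = 0.
Proof.
have [_ [U [h [[[z0 Uz0] oU _ UD] [[hol hp] gE]]]]] := hg.
have [r [zr gB]] := cvg_disc_geom_bounded (UD _ Uz0).
have hK := @geom_complete_complex R.
rewrite recurrence_sumE.
apply: (@exp_sqrt_recurrence R[i] w p e g r z0 U h (fun z => 'D_1 h z) hK
  (@geom_bounded_exp R) he gB zr Uz0 oU _ hp gE) => z Uz.
exact/derivableP/hol.
Qed.
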